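(* Let $W^L$ be a left state, let $\Delta\in\mathbb R$, and let $W^L$ and $W^*$ be connected by a compressive (if $\Delta\ge0$) or expansive (if $\Delta\le0$) left composite wave $W^L=W^{(0)},\dots,W^{(n)}=W^*$ in the sense of the context (satisfying the standing assumptions there), with total velocity change $f^{\mathrm C}(p_{\mathrm h}^*;W^L)=\Delta$. Let $\tilde p_{\mathrm h}^*$ be the unique solution of $\Delta=f^S_{\mathrm h}(\tilde p_{\mathrm h}^*;W^L)$, let $\tilde v_{\mathrm h}^*:=\xi_{\mathrm h}(\tilde p_{\mathrm h}^*;W^L)$ and $\tilde\lambda^-_{1,\mathrm h}:=u^L-v^LQ_{\mathrm h}(\tilde p_{\mathrm h}^*;W^L)$. Then the leftmost wave speed $\lambda_1^-$ of the composite wave satisfies: (i) if the outermost elementary wave (connecting $W^{(0)}$ to $W^{(1)}$) is a rarefaction fan, $\lambda_1^-\ge u^L-\sqrt{a_{\mathrm h}^2(W^L)+a_{\mathrm b}^2(\rho^L)}$; (ii) if the outermost elementary wave is a shock and $\Delta\ge0$, $$\lambda_1^-\ge u^L-\sqrt{\big(u^L-\tilde\lambda^-_{1,\mathrm h}\big)^2+2(v^L)^2\max_{\tilde v_{\mathrm h}^*\le\tau\le v^L}\frac{\hat a_{\mathrm b}^2(\tau)}{\tau^2}};$$ (iii) if the outermost elementary wave is a shock and $\Delta\le0$, $$\lambda_1^-\ge u^L-\sqrt{a_{\mathrm h}^2(W^L)+2(v^L)^2\max_{v^L\le\tau\le\tilde v_{\mathrm h}^*}\frac{\hat a_{\mathrm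 b}^2(\tau)}{\tau^2}}.$$
   Context: Equation of state. $v=1/\rho$ is the specific volume; a hat marks a quantity expressed as a function of $v$. The total pressure is $p=p_{\mathrm h}(\rho,e_{\mathrm h})+p_{\mathrm b}(\rho)$; $p_{\mathrm h}$ is a complete equation of state in density and specific internal energy $e_{\mathrm h}$, with specific entropy $s_{\mathrm h}$ and sound speed $a_{\mathrm h}$; $p_{\mathrm b}(\rho)=\rho^2\partial_\rho e_{\mathrm b}(\rho)$, i.e. $\hat e_{\mathrm b}'(v)=-\hat p_{\mathrm b}(v)$. $\hat e_{\mathrm h}(v,p_{\mathrm h})$ is $e_{\mathrm h}$ as a function of $v$ and $p_{\mathrm h}$. Standing assumptions (constants $p_\infty,q\in\mathbb R$): (A.0) $p_{\mathrm h}>-p_\infty$, $a_{\mathrm h}^2=-v^2\partial_v\hat p_{\mathrm h}|_{s_{\mathrm h}}>0$, $\partial_v^2\hat p_{\mathrm h}|_{s_{\mathrm h}}>0$; (A.1) $\partial_v\hat e_{\mathrm h}|_{p_{\mathrm h}}\ge p_\infty$, $\partial_{p_{\mathrm h}}\hat e_{\mathrm h}|_v\ge0$, $\partial_{s_{\mathrm h}}\hat p_{\mathrm h}|_v>0$, $\hat e_{\mathrm h}\ge q$, $\lim_{v\to0+}\hat e_{\mathrm h}(v,p_{\mathrm h})=q$; (A.2) $e_{\mathrm b}$ is $C^3$ and $a_{\mathrm b}^2(\rho):=\partial_\rho p_{\mathrm b}(\rho)\ge0$, i.e. $\hat a_{\mathrm b}^2(v)=-v^2\hat p_{\mathrm b}'(v)\ge0$.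 States. $W=[\rho,u,p]$ has specific volume $v$, velocity $u$, total pressure $p$ and hydrodynamical pressure $p_{\mathrm h}=p-\hat p_{\mathrm b}(v)$; superscripts label the state. Hydrodynamical shock functions. For a state $W$, $\tilde v=\xi_{\mathrm h}(P;W)$ denotes the solution of $\hat e_{\mathrm h}(\tilde v,P)-\hat e_{\mathrm h}(v,p_{\mathrm h})+\tfrac12(P+p_{\mathrm h})(\tilde v-v)=0$, for $P$ on both sides of $p_{\mathrm h}$; it is strictly decreasing in $P$ with $\xi_{\mathrm h}(p_{\mathrm h};W)=v$. Set $f^S_{\mathrm h}(P;W)=\mathrm{sgn}(P-p_{\mathrm h})|P-p_{\mathrm h}|^{1/2}|v-\xi_{\mathrm h}(P;W)|^{1/2}$ (strictly increasing in $P$) and $Q_{\mathrm h}(P;W)=(|P-p_{\mathrm h}|/|v-\xi_{\mathrm h}(P;W)|)^{1/2}$ (limit at $P=p_{\mathrm h}$). Left composite waves. A left composite wave from $W^L$ to $W^*$ is a finite sequence $W^L=W^{(0)},\dots,W^{(n)}=W^*$, $n\ge1$, consecutive states being connected by an elementary left-facing wave, with speeds of consecutive waves ordered so that the self-similar profile is well defined. Elementary waves from $W^-$ to $W^+$: (i) a shock: $\hat e_{\mathrm h}(v^+,p^+_{\mathrm h})-\hat e_{\mathrm h}(v^-,p^-_{\mathrm h})+\tfrac12(p_{\mathrm h}^++p_{\mathrm h}^-)(v^+-v^-)+\hat A_{\mathrm b}(v^+,v^-)=0$, where $\hat A_{\mathrm b}(w,v)=\hat e_{\mathrm b}(w)-\hat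 e_{\mathrm b}(v)+\tfrac12(\hat p_{\mathrm b}(w)+\hat p_{\mathrm b}(v))(w-v)$, with $u^+=u^--f^S$, $f^S=\pm|p^+-p^-|^{1/2}|v^--v^+|^{1/2}$ ($+$ if $p^+\ge p^-$, $-$ otherwise), and speed $\sigma(W^-,W^+)=u^--v^-Q$, $Q=(|p^+-p^-|/|v^--v^+|)^{1/2}$; (ii) a rarefaction fan: $s_{\mathrm h}$ constant, $u^+=u^--f^R$, $f^R=\int_{\rho^-}^{\rho^+}\rho^{-1}\sqrt{a_{\mathrm h}^2+a_{\mathrm b}^2}\,|_{s_{\mathrm h}}\,d\rho$, with characteristic speed $\lambda(W)=u-\sqrt{a_{\mathrm h}^2+a_{\mathrm b}^2}$. $f^{\mathrm C}(p_{\mathrm h}^*;W^L)=u^L-u^*$ is the sum of the $f^S$, $f^R$ of the individual elementary waves. The composite wave is compressive if $p_{\mathrm h}^{(k)}$ is non-decreasing and $v^{(k)}$ non-increasing in $k$; expansive if $p_{\mathrm h}^{(k)}$ is non-increasing and $v^{(k)}$ non-decreasing in $k$. Standing assumptions: (A.3) $\mathcal G:=v^3(\partial_v^2\hat p_{\mathrm h}|_{s_{\mathrm h}}+\hat p_{\mathrm b}'')/(2(a_{\mathrm h}^2+a_{\mathrm b}^2))\ne0$ along each fan; (A.4) for each shock $W^{(k-1)}\to W^{(k)}$ and every $W$ on the Hugoniot locus between them, $\sigma(W^{(k-1)},W)\ge\sigma(W^{(k-1)},W^{(k)})$; (A.5) a shock adjacent to a fan at $W^{(k)}$ travels at speed $\lambda(W^{(k)})$.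 The leftmost wave speed $\lambda_1^-$ is $\sigma(W^{(0)},W^{(1)})$ if the outermost wave is a shock and $\lambda(W^L)$ if it is a fan. *)

(* Defs.v *)
From Stdlib Require Import Reals ClassicalEpsilon.
From Coquelicot Require Import Coquelicot.

Open Scope R_scope.

Definition between (a b x : R) : Prop := Rmin a b <= x <= Rmax a b.

Definition is_max_on (f : R -> R) (a b M : R) : Prop :=
  (exists t, a <= t <= b /\ f t = M) /\ (forall t, a <= t <= b -> f t <= M).

(** ** Equation of state *)

Record eos := mkEos {
  p_h   : R -> R -> R;  (* pressure,            (rho, e) *)
  s_h   : R -> R -> R;  (* specific entropy,    (rho, e) *)
  e_hat : R -> R -> R;  (* specific energy e_h, (v, p_h) *)
  p_hat : R -> R -> R;  (* pressure p_h,        (v, s_h) *)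
  e_b   : R -> R;       (* barotropic energy,   rho *)
  p_inf : R;
  q_ref : R
}.

Definition entropy (E : eos) (v p : R) : R := s_h E (/ v) (e_hat E v p).

(** The (v, s) image of the phase space {0 < v, - p_inf < p}: [p_hat] carries
    no information outside of it. *)
Definition vs_dom (E : eos) (v s : R) : Prop :=
  0 < v /\ exists p, - p_inf E < p /\ s = entropy E v p.

(** [e_hat] and [p_hat] are the changes of variables attached to [p_h], [s_h];
    the last clause is the Gibbs relation de = T ds - p dv at constant s.
    The temperature is d(e)/ds at constant v, and its positivity follows
    from [hydro_hyperbolic] and [hydro_energy_bounds]. *)
Definition complete_eos (E : eos) : Prop :=
  (forall v p, 0 < v -> - p_inf E < p ->
     p_h E (/ v) (e_hat E v p) = p /\
     p_hat E v (entropy E v p) = p /\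
     ex_diff_n (e_hat E) 1 v p) /\
  open (fun z : R * R => vs_dom E (fst z) (snd z)) /\
  (forall v s, vs_dom E v s ->
     ex_diff_n (p_hat E) 2 v s /\
     is_derive (fun w => e_hat E w (p_hat E w s)) v (- p_hat E v s)).

(** Squared sound speed, as a function of (v, s). *)
Definition ah2 (E : eos) (v s : R) : R :=
  - v ^ 2 * Derive (fun w => p_hat E w s) v.

Definition hydro_hyperbolic (E : eos) : Prop :=
  forall v s, vs_dom E v s ->
    0 < ah2 E v s /\ 0 < Derive_n (fun w => p_hat E w s) 2 v.

Definition hydro_energy_bounds (E : eos) : Prop :=
  (forall v p, 0 < v -> - p_inf E < p ->
     p_inf E <= Derive (fun w => e_hat E w p) v /\
     0 <= Derive (fun r => e_hat E v r) p /\
     q_ref E <= e_hat E v p) /\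
  (forall v s, vs_dom E v s -> 0 < Derive (fun r => p_hat E v r) s) /\
  (forall p, - p_inf E < p ->
     filterlim (fun v => e_hat E v p) (at_right 0) (locally (q_ref E))).

Definition p_b (E : eos) (rho : R) : R := rho ^ 2 * Derive (e_b E) rho.
Definition ab2 (E : eos) (rho : R) : R := Derive (p_b E) rho.

Definition e_b_hat (E : eos) (v : R) : R := e_b E (/ v).
Definition p_b_hat (E : eos) (v : R) : R := p_b E (/ v).
Definition ab2_hat (E : eos) (v : R) : R := ab2 E (/ v).

(** All orders k <= 3 are listed because [ex_derive_n _ 3] alone says nothing
    about the differentiability of the lower derivatives. *)
Definition barotropic_regular (E : eos) : Prop :=
  forall rho, 0 < rho ->
    (forall k, (k <= 3)%nat -> ex_derive_n (e_b E) k rho) /\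
    continuous (Derive_n (e_b E) 3) rho /\
    0 <= ab2 E rho.

(** ** States *)

Record state := mkState { rho : R; u : R; p : R }.

Definition vol (W : state) : R := / rho W.
Definition ph (E : eos) (W : state) : R := p W - p_b_hat E (vol W).
Definition entropy_of (E : eos) (W : state) : R := entropy E (vol W) (ph E W).
Definition ah2_of (E : eos) (W : state) : R := ah2 E (vol W) (entropy_of E W).

Definition admissible (E : eos) (W : state) : Prop :=
  0 < rho W /\ - p_inf E < ph E W.

(** Characteristic speed of the left acoustic field. *)
Definition lambda (E : eos) (W : state) : R :=
  u W - sqrt (ah2_of E W + ab2 E (rho W)).

(** ** Hydrodynamical shock functions *)

Definition hydro_hugoniot (E : eos) (P : R) (W : state) (w : R) : Prop :=
  e_hat E w P - e_hat E (vol W) (ph E W) + / 2 * (P + ph E W) * (w - vol W) = 0.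

(** For P > - p_inf the left-hand side of [hydro_hugoniot] is strictly
    increasing in w, negative near 0 and unbounded above, so [xi_h] is the
    unique solution. *)
Definition xi_h (E : eos) (P : R) (W : state) : R :=
  epsilon (inhabits 0) (fun w => 0 < w /\ hydro_hugoniot E P W w).

Definition fS_h (E : eos) (P : R) (W : state) : R :=
  sign (P - ph E W) * sqrt (Rabs (P - ph E W)) * sqrt (Rabs (vol W - xi_h E P W)).

Definition Q_h_quot (E : eos) (P : R) (W : state) : R :=
  sqrt (Rabs (P - ph E W) / Rabs (vol W - xi_h E P W)).

Definition Q_h (E : eos) (P : R) (W : state) : R :=
  if Req_EM_T P (ph E W)
  then real (Lim (fun P' => Q_h_quot E P' W) (ph E W))
  else Q_h_quot E P W.

(** ** Elementary left-facing waves *)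

Definition A_b_hat (E : eos) (w v : R) : R :=
  e_b_hat E w - e_b_hat E v + / 2 * (p_b_hat E w + p_b_hat E v) * (w - v).

Definition fS (Wm Wp : state) : R :=
  (if Rle_dec (p Wm) (p Wp) then 1 else - 1)
  * (sqrt (Rabs (p Wp - p Wm)) * sqrt (Rabs (vol Wm - vol Wp))).

Definition Q (Wm Wp : state) : R :=
  sqrt (Rabs (p Wp - p Wm) / Rabs (vol Wm - vol Wp)).

Definition sigma (Wm Wp : state) : R := u Wm - vol Wm * Q Wm Wp.

(** Equal volumes are excluded since [Q] would be 0/0; the relations then force
    Wp = Wm anyway. *)
Definition shock (E : eos) (Wm Wp : state) : Prop :=
  vol Wm <> vol Wp /\
  e_hat E (vol Wp) (ph E Wp) - e_hat E (vol Wm) (ph E Wm)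
    + / 2 * (ph E Wp + ph E Wm) * (vol Wp - vol Wm)
    + A_b_hat E (vol Wp) (vol Wm) = 0 /\
  u Wp = u Wm - fS Wm Wp.

(** Velocity drop along the isentrope of Wm, up to density r. *)
Definition fR (E : eos) (Wm : state) (r : R) : R :=
  RInt (fun t => / t * sqrt (ah2 E (/ t) (entropy_of E Wm) + ab2 E t)) (rho Wm) r.

(** The state of specific volume v on the rarefaction curve of Wm. *)
Definition fan_state (E : eos) (Wm : state) (v : R) : state :=
  mkState (/ v) (u Wm - fR E Wm (/ v))
          (p_hat E v (entropy_of E Wm) + p_b_hat E v).

(** The last clause orders the characteristic speeds inside the fan, from Wm to
    Wp, as needed for a self-similar profile. *)
Definition rarefaction (E : eos) (Wm Wp : state) : Prop :=
  entropy_of E Wp = entropy_of E Wm /\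
  u Wp = u Wm - fR E Wm (rho Wp) /\
  (forall v, between (vol Wm) (vol Wp) v -> vs_dom E v (entropy_of E Wm)) /\
  (forall v v', between (vol Wm) (vol Wp) v' -> between (vol Wm) v' v ->
     lambda E (fan_state E Wm v) <= lambda E (fan_state E Wm v')).

Inductive wave_kind := Shock | Fan.

Definition elementary_wave (E : eos) (k : wave_kind) (Wm Wp : state) : Prop :=
  match k with Shock => shock E Wm Wp | Fan => rarefaction E Wm Wp end.

Definition wave_f (E : eos) (k : wave_kind) (Wm Wp : state) : R :=
  match k with Shock => fS Wm Wp | Fan => fR E Wm (rho Wp) end.

Definition left_speed (E : eos) (k : wave_kind) (Wm Wp : state) : R :=
  match k with Shock => sigma Wm Wp | Fan => lambda E Wm end.

Definition right_speed (E : eos) (k : wave_kind) (Wm Wp : state) : R :=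
  match k with Shock => sigma Wm Wp | Fan => lambda E Wp end.

(** ** Left composite waves

    Wave k, of kind [K k], connects [W k] to [W (S k)], for k < n. *)

Definition left_composite_wave
    (E : eos) (n : nat) (W : nat -> state) (K : nat -> wave_kind) : Prop :=
  (1 <= n)%nat /\
  (forall k, (k <= n)%nat -> admissible E (W k)) /\
  (forall k, (k < n)%nat -> elementary_wave E (K k) (W k) (W (S k))) /\
  (forall k, (S k < n)%nat ->
     right_speed E (K k) (W k) (W (S k))
     <= left_speed E (K (S k)) (W (S k)) (W (S (S k)))).

(** [sum_f_R0 f m] has m + 1 terms, and n >= 1. *)
Definition fC (E : eos) (n : nat) (W : nat -> state) (K : nat -> wave_kind) : R :=
  sum_f_R0 (fun k => wave_f E (K k) (W k) (W (S k))) (n - 1).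

Definition compressive (E : eos) (n : nat) (W : nat -> state) : Prop :=
  forall k, (k < n)%nat ->
    ph E (W k) <= ph E (W (S k)) /\ vol (W (S k)) <= vol (W k).

Definition expansive (E : eos) (n : nat) (W : nat -> state) : Prop :=
  forall k, (k < n)%nat ->
    ph E (W (S k)) <= ph E (W k) /\ vol (W k) <= vol (W (S k)).

(** Fundamental derivative of the total pressure. *)
Definition G (E : eos) (v s : R) : R :=
  v ^ 3 * (Derive_n (fun w => p_hat E w s) 2 v + Derive_n (p_b_hat E) 2 v)
  / (2 * (ah2 E v s + ab2_hat E v)).

Definition fans_genuinely_nonlinear
    (E : eos) (n : nat) (W : nat -> state) (K : nat -> wave_kind) : Prop :=
  forall k, (k < n)%nat -> K k = Fan ->
    forall v, between (vol (W k)) (vol (W (S k))) v ->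
      G E v (entropy_of E (W k)) <> 0.

(** Liu's condition; "between" is understood both in v and in p_h. *)
Definition shocks_liu
    (E : eos) (n : nat) (W : nat -> state) (K : nat -> wave_kind) : Prop :=
  forall k, (k < n)%nat -> K k = Shock ->
    forall V, admissible E V -> shock E (W k) V ->
      between (vol (W k)) (vol (W (S k))) (vol V) ->
      between (ph E (W k)) (ph E (W (S k))) (ph E V) ->
      sigma (W k) (W (S k)) <= sigma (W k) V.

Definition sonic_attachment
    (E : eos) (n : nat) (W : nat -> state) (K : nat -> wave_kind) : Prop :=
  forall k, (S k < n)%nat ->
    (K k = Shock -> K (S k) = Fan ->
       sigma (W k) (W (S k)) = lambda E (W (S k))) /\
    (K k = Fan -> K (S k) = Shock ->
       sigma (W (S k)) (W (S (S k))) = lambda E (W (S k))).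

(* Main.v *)
Require Import Defs.
From Stdlib Require Import Reals.
From Coquelicot Require Import Coquelicot.
From Stdlib Require Import Ranalysis5 ClassicalEpsilon Lra Lia Psatz.
Open Scope R_scope.

(** In a compressive (expansive) wave every elementary wave contributes a
    velocity change of the same sign, so the first shock satisfies
    [|p1 - p0| |v0 - v1| <= Delta ^ 2], where p is the total pressure and Delta^2
    is the same product for the hydrodynamical shock to (v_t, p_t).
    By monotonicity of p_b the term [A_b_hat] is at most half of
    [|p_b(v1) - p_b(v0)| |v1 - v0|], whence the factor 2 in front of the maximum.

    The equation of state enters through two facts. First, [e_hat v p - p_inf v]
    is nondecreasing in v and e_hat is nondecreasing in p. Second, along a line
    of slope -m in the (v, p) plane the Hugoniot function has no interior
    minimum: at a critical point the line is tangent to an isentrope, which is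
    strictly convex. Applied to the chord of the hydrodynamical shock
    (compression), or to the tangent of the isentrope at the initial state
    (expansion), this bounds the energy on the line; comparing with the state
    behind the first shock bounds its mass flux. *)

(** * Regularity and monotonicity of the hydrodynamical energy *)

Lemma open_phase_space (E : eos) (v p : R) :
  0 < v -> - p_inf E < p ->
  locally (v, p) (fun z : R * R => 0 < fst z /\ - p_inf E < snd z).
Proof.
  intros Hv Hp.
  assert (He : 0 < Rmin v (p + p_inf E)) by (apply Rmin_pos; lra).
  exists (mkposreal _ He); intros [a b] [Ha Hb].
  cbv [ball] in Ha, Hb; simpl in Ha, Hb.
  cbv [AbsRing_ball abs minus plus opp] in Ha, Hb; simpl in Ha, Hb.
  apply Rabs_def2 in Ha; apply Rabs_def2 in Hb.
  pose proof (Rmin_l v (p + p_inf E)); pose proof (Rmin_r v (p + p_inf E)).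
  simpl; split; lra.
Qed.

Lemma e_hat_partials (E : eos) (v p : R) :
  complete_eos E -> 0 < v -> - p_inf E < p ->
  is_derive (fun w => e_hat E w p) v (Derive (fun w => e_hat E w p) v) /\
  is_derive (fun r => e_hat E v r) p (Derive (fun r => e_hat E v r) p).
Proof.
  intros [H _] Hv Hp.
  destruct (H v p Hv Hp) as [_ [_ [_ [H1 [H2 _]]]]].
  split; apply Derive_correct; assumption.
Qed.

(** Joint differentiability follows from the existence of the v-partial in a neighbourhood, its
    continuity at the point, and the existence of the p-partial at the point alone. It is what the
    chain rule along curves in the (v, p) plane requires. *)
Lemma e_hat_differentiable (E : eos) (v p : R) :
  complete_eos E -> 0 < v -> - p_inf E < p ->
  differentiable_pt_lim (e_hat E) v p
    (Derive (fun w => e_hat E w p) v) (Derive (fun r => e_hat E v r) p).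
Proof.
  intros Heos Hv Hp.
  apply filterdiff_differentiable_pt_lim.
  apply (is_derive_filterdiff (e_hat E) v p
           (fun a b => Derive (fun w => e_hat E w b) a)).
  - apply (filter_imp (fun z : R * R => 0 < fst z /\ - p_inf E < snd z)).
    + intros [a b] [Ha Hb]; apply e_hat_partials; assumption.
    + apply open_phase_space; assumption.
  - apply e_hat_partials; assumption.
  - destruct Heos as [H _].
    destruct (H v p Hv Hp) as [_ [_ [_ [_ [_ [[H3 _] _]]]]]].
    apply continuity_2d_pt_filterlim in H3; exact H3.
Qed.

Lemma is_derive_e_hat_comp (E : eos) (f : R -> R) (v l : R) :
  complete_eos E -> 0 < v -> - p_inf E < f v -> is_derive f v l ->
  is_derive (fun w => e_hat E w (f w)) v
    (Derive (fun w => e_hat E w (f v)) v + Derive (fun r => e_hat E v r) (f v) * l).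
Proof.
  intros Heos Hv Hp Hf.
  apply is_derive_Reals.
  rewrite <- (Rmult_1_r (Derive (fun w => e_hat E w (f v)) v)).
  apply (derivable_pt_lim_comp_2d (e_hat E) (fun w => w) f v).
  - apply e_hat_differentiable; assumption.
  - apply derivable_pt_lim_id.
  - apply is_derive_Reals; assumption.
Qed.

Lemma MVT_is_derive (f df : R -> R) (a b : R) :
  a <= b -> (forall x, a <= x <= b -> is_derive f x (df x)) ->
  exists c, a <= c <= b /\ f b - f a = df c * (b - a).
Proof.
  intros [Hab | <-] Hd.
  - destruct (MVT_cor2 f df a b Hab) as [c [Hc Hc']].
    + intros x Hx; apply is_derive_Reals, Hd, Hx.
    + exists c; split; [lra | exact Hc].
  - exists a; split; [lra | ring].
Qed.

(** Mean value theorem along two legs: first from [v] to [w] at pressure [r], then from [r] to [s]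
    at volume [w]. Both legs stay in the phase space. *)
Lemma e_hat_increasing (E : eos) (v w r s : R) :
  complete_eos E -> hydro_energy_bounds E ->
  0 < v <= w -> - p_inf E < r <= s ->
  e_hat E v r + p_inf E * (w - v) <= e_hat E w s.
Proof.
  intros Heos [Hb _] Hv Hr.
  destruct (MVT_is_derive (fun x => e_hat E x r) (fun x => Derive (fun x => e_hat E x r) x)
              v w) as [c [Hc Hc']]; [lra | |].
  { intros x Hx; apply e_hat_partials; auto; lra. }
  destruct (MVT_is_derive (fun x => e_hat E w x) (fun x => Derive (fun x => e_hat E w x) x)
              r s) as [d [Hd Hd']]; [lra | |].
  { intros x Hx; apply e_hat_partials; auto; lra. }
  destruct (Hb c r) as [H1 _]; [lra | lra |].
  destruct (Hb w d) as [_ [H2 _]]; [lra | lra |].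
  assert (p_inf E * (w - v) <= Derive (fun x => e_hat E x r) c * (w - v))
    by (apply Rmult_le_compat_r; lra).
  assert (0 <= Derive (fun x => e_hat E w x) d * (s - r))
    by (apply Rmult_le_pos; lra).
  cbv beta in *; lra.
Qed.

(** * Isentropes and the energy along Rayleigh lines *)

Lemma p_hat_derive (E : eos) (v s : R) :
  complete_eos E -> vs_dom E v s ->
  is_derive (fun w => p_hat E w s) v (Derive (fun w => p_hat E w s) v) /\
  is_derive (fun w => Derive (fun z => p_hat E z s) w) v
    (Derive_n (fun w => p_hat E w s) 2 v).
Proof.
  intros [_ [_ H]] Hd.
  destruct (H v s Hd) as [[_ [H1 [_ [[_ [H2 _]] _]]]] _].
  split; apply Derive_correct; assumption.
Qed.

Lemma vs_dom_neighborhood (E : eos) (v s : R) :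
  complete_eos E -> vs_dom E v s ->
  exists d, 0 < d /\ forall w, Rabs (w - v) < d -> vs_dom E w s.
Proof.
  intros [_ [Ho _]] Hd.
  destruct (Ho (v, s) Hd) as [d Hd'].
  exists d; split; [apply cond_pos |].
  intros w Hw; apply (Hd' (w, s)); split; [exact Hw | apply ball_center].
Qed.

(** On the Rayleigh line of slope [- m] through (v0, p0), the hydrodynamical
    Hugoniot function is [rayleigh_energy E v0 p0 m v - e_hat E v0 p0]. *)
Definition rayleigh_energy (E : eos) (v0 p0 m v : R) : R :=
  e_hat E v (p0 - m * (v - v0)) + p0 * (v - v0) - / 2 * m * (v - v0) ^ 2.

Definition rayleigh_energy_slope (E : eos) (v0 p0 m v : R) : R :=
  Derive (fun w => e_hat E w (p0 - m * (v - v0))) v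
  + Derive (fun r => e_hat E v r) (p0 - m * (v - v0)) * (- m)
  + (p0 - m * (v - v0)).

Lemma is_derive_rayleigh_energy (E : eos) (v0 p0 m v : R) :
  complete_eos E -> 0 < v -> - p_inf E < p0 - m * (v - v0) ->
  is_derive (rayleigh_energy E v0 p0 m) v (rayleigh_energy_slope E v0 p0 m v).
Proof.
  intros Heos Hv Hp.
  unfold rayleigh_energy, rayleigh_energy_slope.
  assert (Hl : is_derive (fun w => p0 - m * (w - v0)) v (- m)).
  { auto_derive; [exact I | ring]. }
  pose proof (is_derive_e_hat_comp E (fun w => p0 - m * (w - v0)) v (- m) Heos Hv Hp Hl)
    as H1.
  assert (H2 : is_derive (fun w => p0 * (w - v0) - / 2 * m * (w - v0) ^ 2) v
                 (p0 - m * (v - v0))).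
  { auto_derive; [exact I | field]. }
  pose proof (is_derive_plus _ _ _ _ _ H1 H2) as H3.
  eapply is_derive_ext; [| exact H3].
  intros t; unfold plus; simpl; ring.
Qed.

(** The derivative of the energy along the isentrope is computed twice, by the chain rule and by the
    Gibbs relation. If the p-partial vanished, the v-partial would equal [- p < p_inf E], against
    [hydro_energy_bounds]. *)
Lemma isentrope_slope (E : eos) (v p : R) :
  complete_eos E -> hydro_energy_bounds E -> 0 < v -> - p_inf E < p ->
  Derive (fun w => e_hat E w p) v
    + Derive (fun r => e_hat E v r) p * Derive (fun w => p_hat E w (entropy E v p)) v = - p
  /\ Derive (fun r => e_hat E v r) p <> 0.
Proof.
  intros Heos Hb Hv Hp.
  assert (Hd : vs_dom E v (entropy E v p)) by (split; [| exists p]; auto).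
  assert (Hps : p_hat E v (entropy E v p) = p) by (apply Heos; auto).
  destruct (p_hat_derive E v _ Heos Hd) as [H1 _].
  assert (H2 := is_derive_e_hat_comp E (fun w => p_hat E w (entropy E v p)) v
    (Derive (fun w => p_hat E w (entropy E v p)) v) Heos Hv).
  cbv beta in H2; rewrite Hps in H2; specialize (H2 Hp H1).
  destruct Heos as [_ [_ HG]].
  destruct (HG v _ Hd) as [_ H3]; rewrite Hps in H3.
  apply is_derive_unique in H2; apply is_derive_unique in H3.
  assert (H4 : Derive (fun w => e_hat E w p) v
    + Derive (fun r => e_hat E v r) p * Derive (fun w => p_hat E w (entropy E v p)) v = - p).
  { transitivity (Derive (fun w => e_hat E w (p_hat E w (entropy E v p))) v);
      [symmetry |]; assumption. }
  split; [exact H4 |].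
  intros H0; rewrite H0 in H4.
  destruct Hb as [Hb _]; destruct (Hb v p Hv Hp) as [H5 _]; lra.
Qed.

(** Strict convexity, through the mean value theorem for the function and then for its slope. The
    statement is local because [vs_dom] is only known to be open. *)
Lemma isentrope_above_tangent (E : eos) (v s : R) :
  complete_eos E -> hydro_hyperbolic E -> vs_dom E v s ->
  exists d, 0 < d /\ forall w, v < w < v + d -> vs_dom E w s /\
    p_hat E v s + Derive (fun z => p_hat E z s) v * (w - v) < p_hat E w s.
Proof.
  intros Heos Hh Hd.
  destruct (vs_dom_neighborhood E v s Heos Hd) as [d [Hd0 Hdom]].
  assert (Hdom' : forall w, v <= w < v + d -> vs_dom E w s).
  { intros w Hw; apply Hdom; apply Rabs_def1; lra. }
  exists d; split; [exact Hd0 |]; intros w Hw; split; [apply Hdom'; lra |].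
  destruct (MVT_cor2 (fun z => p_hat E z s) (fun x => Derive (fun z => p_hat E z s) x) v w)
    as [c [Hc Hcw]]; [lra | |].
  { intros x Hx; apply is_derive_Reals, p_hat_derive; [assumption | apply Hdom'; lra]. }
  destruct (MVT_cor2 (fun x => Derive (fun z => p_hat E z s) x)
              (fun x => Derive_n (fun z => p_hat E z s) 2 x) v c)
    as [b [Hb Hbc]]; [lra | |].
  { intros x Hx; apply is_derive_Reals, p_hat_derive; [assumption | apply Hdom'; lra]. }
  destruct (Hh b s) as [_ H2]; [apply Hdom'; lra |].
  cbv beta in *.
  assert (0 < Derive_n (fun z => p_hat E z s) 2 b * (c - v)) by (apply Rmult_lt_0_compat; lra).
  assert (Derive (fun z => p_hat E z s) v * (w - v) < Derive (fun z => p_hat E z s) c * (w - v))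
    by (apply Rmult_lt_compat_r; lra).
  lra.
Qed.

(* A stationary point of [rayleigh_energy] is a point where the Rayleigh line
   is tangent to an isentrope. To its right the isentrope lies above the line,
   and the energy along the isentrope is governed by the Gibbs relation. *)
Lemma rayleigh_energy_stationary (E : eos) (v0 p0 m v : R) :
  complete_eos E -> hydro_hyperbolic E -> hydro_energy_bounds E ->
  0 < v -> - p_inf E < p0 - m * (v - v0) ->
  rayleigh_energy_slope E v0 p0 m v = 0 ->
  exists d, 0 < d /\ forall w, v < w < v + d -> - p_inf E < p0 - m * (w - v0) ->
    rayleigh_energy E v0 p0 m w < rayleigh_energy E v0 p0 m v.
Proof.
  intros Heos Hh Hb Hv Hp H0.
  unfold rayleigh_energy_slope in H0.
  set (pv := p0 - m * (v - v0)) in *.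
  destruct (isentrope_slope E v pv Heos Hb Hv Hp) as [Hs Hne].
  assert (Hd : vs_dom E v (entropy E v pv)) by (split; [| exists pv]; auto).
  assert (Hps : p_hat E v (entropy E v pv) = pv) by (apply Heos; auto).
  set (s := entropy E v pv) in *.
  (* The difference of [H0] and [Hs] is the p-partial of the energy times the sum of [m] and the
     isentrope slope. *)
  assert (Hm : Derive (fun w => p_hat E w s) v = - m).
  { apply (Rmult_eq_reg_l (Derive (fun r => e_hat E v r) pv)); [lra | exact Hne]. }
  destruct (isentrope_above_tangent E v s Heos Hh Hd) as [d [Hd0 Hab]].
  rewrite Hm, Hps in Hab.
  exists d; split; [exact Hd0 |]; intros w Hw Hpw.
  (* The same functional taken along the isentrope has derivative (pressure on the line) - (pressure
     on the isentrope), which is negative to the right of [v]. At [w] the line lies below the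
     isentrope, so passing to the line does not raise the energy. *)
  destruct (MVT_cor2
    (fun z => e_hat E z (p_hat E z s) + (p0 * (z - v0) - / 2 * m * (z - v0) ^ 2))
    (fun z => - p_hat E z s + (p0 - m * (z - v0))) v w) as [c [Hc Hcw]]; [lra | |].
  { intros z Hz; apply is_derive_Reals.
    apply (is_derive_plus (fun z => e_hat E z (p_hat E z s))).
    - apply Heos; destruct (Req_dec z v) as [-> | Hzv]; [exact Hd |].
      apply Hab; lra.
    - auto_derive; [exact I | field]. }
  cbv beta in Hc; rewrite Hps in Hc.
  destruct (Hab c) as [_ Hc1]; [lra |].
  destruct (Hab w) as [Hdw Hw1]; [lra |].
  assert (Hlt : (- p_hat E c s + (p0 - m * (c - v0))) * (w - v) < 0).
  { apply Rmult_neg_pos; unfold pv in Hc1; lra. }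
  pose proof (e_hat_increasing E w w (p0 - m * (w - v0)) (p_hat E w s) Heos Hb) as Hle.
  unfold rayleigh_energy; fold pv.
  unfold pv in *; lra.
Qed.

(** An interior minimizer would be stationary, yet [rayleigh_energy_stationary] gives smaller values
    just to its right. Hence the minimum over [[a, b]] sits at an endpoint. *)
Lemma rayleigh_energy_quasiconcave (E : eos) (v0 p0 m a b v : R) :
  complete_eos E -> hydro_hyperbolic E -> hydro_energy_bounds E ->
  0 < a -> a <= v <= b ->
  (forall w, a <= w <= b -> - p_inf E < p0 - m * (w - v0)) ->
  Rmin (rayleigh_energy E v0 p0 m a) (rayleigh_energy E v0 p0 m b)
  <= rayleigh_energy E v0 p0 m v.
Proof.
  intros Heos Hh Hb Ha Hv Hp.
  set (g := rayleigh_energy E v0 p0 m).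
  assert (Hder : forall c, a <= c <= b -> is_derive g c (rayleigh_energy_slope E v0 p0 m c)).
  { intros c Hc; apply is_derive_rayleigh_energy; auto; lra. }
  destruct (continuity_ab_min g a b) as [c [Hmin Hc]]; [lra | |].
  { intros c Hc; apply derivable_continuous_pt; eexists.
    apply is_derive_Reals; apply Hder; exact Hc. }
  apply Rle_trans with (g c); [| apply Hmin; lra].
  destruct (Req_dec c a) as [-> | Hca]; [apply Rmin_l |].
  destruct (Req_dec c b) as [-> | Hcb]; [apply Rmin_r |].
  exfalso.
  assert (H0 : rayleigh_energy_slope E v0 p0 m c = 0).
  { assert (Hd := Hder c Hc). apply is_derive_Reals in Hd.
    rewrite <- (derive_pt_eq_0 _ _ _ (exist _ _ Hd) Hd).
    apply (deriv_minimum g a b); try lra.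
    intros x Hx1 Hx2; apply Hmin; lra. }
  destruct (rayleigh_energy_stationary E v0 p0 m c) as [d [Hd Hlt]]; auto; try lra.
  assert (Hw : 0 < Rmin d (b - c)) by (apply Rmin_pos; lra).
  pose proof (Rmin_l d (b - c)); pose proof (Rmin_r d (b - c)).
  specialize (Hlt (c + Rmin d (b - c) / 2)).
  assert (g (c + Rmin d (b - c) / 2) < g c).
  { apply Hlt; [lra | apply Hp; lra]. }
  specialize (Hmin (c + Rmin d (b - c) / 2)); lra.
Qed.

(** * Bounds on the mass flux of the first shock *)

(* [b0], [b1] are the barotropic pressures and [mu] is the mean of p_b over
   [v1, v0]. If the claim failed, the point of the chord from (v0, p0) to
   (vt, pt) at distance [w = sqrt (S x / m)], i.e. with the same velocity jump
   as the shock, would have smaller volume and pressure than (v1, p1), but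
   energy that is too large for [e_hat_increasing]. *)
Lemma compressive_shock_flux (E : eos) (v0 p0 v1 p1 b0 b1 mu M vt pt : R) :
  complete_eos E -> hydro_hyperbolic E -> hydro_energy_bounds E ->
  - p_inf E < p0 <= p1 -> p0 < pt -> 0 < v1 < v0 -> 0 < vt < v0 ->
  b0 <= mu <= b1 -> 0 <= M -> (vt <= v1 -> b1 - b0 <= M * (v0 - v1)) ->
  e_hat E v1 p1 - e_hat E v0 p0
    = (/ 2 * (p1 + p0) + / 2 * (b1 + b0) - mu) * (v0 - v1) ->
  e_hat E vt pt - e_hat E v0 p0 = / 2 * (pt + p0) * (v0 - vt) ->
  (p1 + b1 - p0 - b0) * (v0 - v1) <= (pt - p0) * (v0 - vt) ->
  (p1 + b1 - p0 - b0) / (v0 - v1) <= (pt - p0) / (v0 - vt) + 2 * M.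
Proof.
  intros Heos Hh Hb Hp Hpt Hv1 Hvt Hmu HM Hbar H1 Ht HD.
  set (x := v0 - v1) in *; set (D := v0 - vt) in *.
  set (S := p1 + b1 - p0 - b0) in *.
  set (m := (pt - p0) / D).
  assert (Hx : 0 < x) by (unfold x; lra).
  assert (HD0 : 0 < D) by (unfold D; lra).
  assert (Hm : 0 < m) by (apply Rdiv_lt_0_compat; lra).
  assert (HmD : m * D = pt - p0) by (unfold m; field; lra).
  rewrite <- HmD in HD.
  apply Rnot_lt_le; intros Hcon.
  apply (Rmult_lt_compat_r x) in Hcon; [| exact Hx].
  replace (S / x * x) with S in Hcon by (field; lra).
  assert (Hmx : m * x < S) by nra.
  assert (HmS : m * (x * x) < S * x) by nra.
  (* Since [m * (x * x) < S * x <= m * D * D], the volume [v1] lies strictly between [vt] and [v0],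
     which makes [Hbar] available. *)
  assert (HxD : x < D).
  { apply Rnot_le_lt; intros HDx. assert (D * D <= x * x) by nra. nra. }
  specialize (Hbar ltac:(unfold x, D in *; lra)).
  assert (HSx : 0 < S * x) by nra.
  set (w := sqrt (S * x / m)).
  assert (Hw2 : m * (w * w) = S * x).
  { unfold w; rewrite sqrt_sqrt; [field; lra |].
    apply Rlt_le, Rdiv_lt_0_compat; lra. }
  assert (Hw0 : 0 < w) by (apply sqrt_lt_R0, Rdiv_lt_0_compat; lra).
  assert (HwD : w <= D).
  { apply Rnot_lt_le; intros HDw. assert (D * D < w * w) by nra. nra. }
  assert (Hxw : x < w).
  { apply Rnot_le_lt; intros Hwx. assert (w * w <= x * x) by nra. nra. }
  (* AM-GM for [S] and [m x], whose product is [(m w)^2] *)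
  assert (Hpc : p0 + m * w <= p1).
  { assert (Hag : (2 * (m * w)) * (2 * (m * w)) <= (S + m * x) * (S + m * x)).
    { assert (0 <= (S - m * x) * (S - m * x)) by (apply Rle_0_sqr).
      replace (2 * (m * w) * (2 * (m * w))) with (4 * m * (m * (w * w))) by ring.
      rewrite Hw2; lra. }
    assert (2 * (m * w) <= S + m * x).
    { apply Rsqr_incr_0_var; [exact Hag | nra]. }
    (* With [b1 - b0 <= M * x] and [m * x + 2 * M * x < S], the mean of [S] and [m * x] is at most
       [S - (b1 - b0) = p1 - p0]. The factor 2 is consumed here. *)
    unfold S in *; lra. }
  assert (Hmw : 0 < m * w) by (apply Rmult_lt_0_compat; lra).
  pose proof (rayleigh_energy_quasiconcave E v0 p0 m vt v0 (v0 - w) Heos Hh Hb) as Hq.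
  (* The Rayleigh energy equals [e_hat E v0 p0] at both ends of the chord: trivially at [v0], and at
     [vt] by the Hugoniot relation [Ht]. *)
  assert (Hgc : e_hat E v0 p0 <= rayleigh_energy E v0 p0 m (v0 - w)).
  { eapply Rle_trans; [| apply Hq; unfold D in *; try lra].
    - apply Rmin_glb; unfold rayleigh_energy.
      + replace (p0 - m * (vt - v0)) with pt by (unfold D in HmD; lra).
        replace (e_hat E vt pt) with (e_hat E v0 p0 + / 2 * (pt + p0) * D) by lra.
        replace (vt - v0) with (- D) by (unfold D; ring).
        replace (pt) with (p0 + m * D) by lra.
        apply Req_le; field.
      + replace (p0 - m * (v0 - v0)) with p0 by ring. apply Req_le; ring.
    - intros z Hz. assert (0 <= m * (v0 - z)) by (apply Rmult_le_pos; lra). lra. }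
  unfold rayleigh_energy in Hgc.
  replace (p0 - m * (v0 - w - v0)) with (p0 + m * w) in Hgc by ring.
  pose proof (e_hat_increasing E (v0 - w) v1 (p0 + m * w) p1 Heos Hb) as He.
  specialize (He ltac:(unfold x, D in *; lra) ltac:(lra)).
  (* As [m * (w * w) = S * x], the quadratic terms cancel between [He], [Hgc] and [H1]. What remains
     is [(p0 + p_inf E) * (w - x) <= (b0 - mu) * x], a positive number below a nonpositive one. *)
  assert (Hmu' : (b0 - mu) * x <= 0) by nra.
  assert (0 < (p0 + p_inf E) * (w - x)) by (apply Rmult_lt_0_compat; lra).
  replace (v1 - (v0 - w)) with (w - x) in He by (unfold x; ring).
  replace (v0 - w - v0) with (- w) in Hgc by ring.
  unfold S in *. nra.
Qed.

(** Places the first shock inside the volume interval over which the maximum is taken. If [vt < v1],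
    then either [p1 <= pt] and the product in [HD] is too large, or [(v1, p1)] exceeds [(vt, pt)] in
    both coordinates and its energy is too small for [e_hat_increasing]. *)
Lemma expansive_shock_volume (E : eos) (v0 p0 v1 p1 b0 b1 mu vt pt : R) :
  complete_eos E -> hydro_energy_bounds E ->
  - p_inf E < p1 <= p0 -> - p_inf E < pt < p0 -> 0 < v0 < v1 -> v0 < vt ->
  b1 <= mu <= b0 ->
  e_hat E v1 p1 - e_hat E v0 p0
    = (mu - / 2 * (p1 + p0) - / 2 * (b1 + b0)) * (v1 - v0) ->
  e_hat E vt pt - e_hat E v0 p0 = - (/ 2 * (pt + p0) * (vt - v0)) ->
  (p0 + b0 - p1 - b1) * (v1 - v0) <= (p0 - pt) * (vt - v0) ->
  v1 <= vt.
Proof.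
  intros Heos Hb Hp Hpt Hv1 Hvt Hmu H1 Ht HD.
  apply Rnot_lt_le; intros Hcon.
  destruct (Rle_lt_dec p1 pt) as [Hle | Hlt].
  - assert ((p0 - pt) * (v1 - v0) <= (p0 + b0 - p1 - b1) * (v1 - v0))
      by (apply Rmult_le_compat_r; lra).
    nra.
  - pose proof (e_hat_increasing E vt v1 pt p1 Heos Hb ltac:(lra) ltac:(lra)) as He.
    (* Eliminating [p1] and [pt] through [HD] leaves [(p0 + p_inf E) * (v1 - vt) <= (mu - b0) * (v1
       - v0)], which is impossible. *)
    assert ((mu - b0) * (v1 - v0) <= 0) by nra.
    assert (0 < (p0 + p_inf E) * (v1 - vt)) by (apply Rmult_lt_0_compat; lra).
    nra.
Qed.

(* The tangent at (v0, p0) to the isentrope is a Rayleigh line on which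
   [rayleigh_energy] starts with slope 0, hence stays below its initial value. *)
Lemma expansive_shock_flux (E : eos) (v0 p0 v1 p1 b0 b1 mu M : R) :
  complete_eos E -> hydro_hyperbolic E -> hydro_energy_bounds E ->
  - p_inf E < p1 <= p0 -> 0 < v0 < v1 ->
  b1 <= mu <= b0 -> b0 - b1 <= M * (v1 - v0) ->
  e_hat E v1 p1 - e_hat E v0 p0
    = (mu - / 2 * (p1 + p0) - / 2 * (b1 + b0)) * (v1 - v0) ->
  (p0 + b0 - p1 - b1) / (v1 - v0)
    <= - Derive (fun w => p_hat E w (entropy E v0 p0)) v0 + 2 * M.
Proof.
  intros Heos Hh Hb Hp Hv Hmu HM H1.
  destruct (isentrope_slope E v0 p0 Heos Hb ltac:(lra) ltac:(lra)) as [Hs Hne].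
  assert (Hc : 0 < - Derive (fun w => p_hat E w (entropy E v0 p0)) v0).
  { destruct (Hh v0 (entropy E v0 p0)) as [Ha _]; [split; [lra | exists p0; split; [lra | reflexivity]] |].
    unfold ah2 in Ha. nra. }
  set (c := - Derive (fun w => p_hat E w (entropy E v0 p0)) v0) in *.
  set (x := v1 - v0) in *.
  assert (Hx : 0 < x) by (unfold x; lra).
  apply Rnot_lt_le; intros Hcon.
  apply (Rmult_lt_compat_r x) in Hcon; [| exact Hx].
  replace ((p0 + b0 - p1 - b1) / x * x) with (p0 + b0 - p1 - b1) in Hcon by (field; lra).
  (* Here [0 <= b0 - b1 <= M * x], so [(v1, p1)] lies below the tangent. The tangent therefore stays
     in the phase space up to [v1]. *)
  assert (Hpl : p1 < p0 - c * x) by lra.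
  assert (Hdom : forall w, v0 <= w <= v1 -> - p_inf E < p0 - c * (w - v0)).
  { intros w Hw. assert (c * (w - v0) <= c * x) by (apply Rmult_le_compat_l; unfold x; lra). lra. }
  set (g := rayleigh_energy E v0 p0 c).
  assert (Hg0 : g v0 = e_hat E v0 p0).
  { unfold g, rayleigh_energy. replace (p0 - c * (v0 - v0)) with p0 by ring. ring. }
  destruct (rayleigh_energy_stationary E v0 p0 c v0) as [d [Hd Hlt]]; auto; try lra.
  { unfold rayleigh_energy_slope. replace (p0 - c * (v0 - v0)) with p0 by ring.
    unfold c. lra. }
  (* The energy drops just to the right of [v0]. If it were back to [g v0] or more at [v1],
     quasiconcavity would forbid that drop. *)
  assert (Hg1 : g v1 < g v0).
  { apply Rnot_le_lt; intros Hle.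
    pose proof (Rmin_l d x); pose proof (Rmin_r d x).
    assert (0 < Rmin d x) by (apply Rmin_pos; lra).
    set (w := v0 + Rmin d x / 2).
    assert (Hw : v0 <= w <= v1) by (unfold w, x in *; lra).
    assert (g w < g v0) by (apply Hlt; [unfold w; lra | apply Hdom; exact Hw]).
    pose proof (rayleigh_energy_quasiconcave E v0 p0 c v0 v1 w Heos Hh Hb
                  ltac:(lra) Hw Hdom) as Hq.
    fold g in Hq. rewrite Rmin_left in Hq by exact Hle. lra. }
  rewrite Hg0 in Hg1; unfold g, rayleigh_energy in Hg1.
  pose proof (e_hat_increasing E v1 v1 p1 (p0 - c * x) Heos Hb ltac:(lra) ltac:(lra)) as He.
  fold x in Hg1.
  (* After division by [x] the inequalities combine to [M * x < b0 - mu], against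
     [b0 - mu <= b0 - b1 <= M * x]. *)
  assert ((b1 - mu) * x <= 0) by nra.
  assert (- ((b0 - b1) * x) >= - (M * x * x)) by nra.
  nra.
Qed.

(** * Barotropic pressure and energy as functions of the specific volume *)

Lemma e_b_derivatives (E : eos) (r : R) :
  barotropic_regular E -> 0 < r ->
  is_derive (e_b E) r (Derive (e_b E) r) /\
  is_derive (Derive (e_b E)) r (Derive_n (e_b E) 2 r) /\
  ex_derive (Derive_n (e_b E) 2) r.
Proof.
  intros H Hr; destruct (H r Hr) as [Hk _].
  split; [| split].
  - apply Derive_correct; exact (Hk 1%nat ltac:(lia)).
  - apply Derive_correct; exact (Hk 2%nat ltac:(lia)).
  - exact (Hk 3%nat ltac:(lia)).
Qed.

Lemma is_derive_p_b (E : eos) (r : R) :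
  barotropic_regular E -> 0 < r ->
  is_derive (p_b E) r (2 * r * Derive (e_b E) r + r ^ 2 * Derive_n (e_b E) 2 r).
Proof.
  intros H Hr; destruct (e_b_derivatives E r H Hr) as [_ [H2 _]].
  assert (H3 : is_derive (fun t => t ^ 2) r (2 * r)) by (auto_derive; [exact I | ring]).
  exact (is_derive_mult _ _ _ _ _ H3 H2 Rmult_comm).
Qed.

(** Near [r], [ab2] coincides with the formula of [is_derive_p_b], which is differentiable because
    [e_b] has a third derivative. *)
Lemma continuous_ab2 (E : eos) (r : R) :
  barotropic_regular E -> 0 < r -> continuous (ab2 E) r.
Proof.
  intros H Hr.
  apply (continuous_ext_loc _
    (fun t => 2 * t * Derive (e_b E) t + t ^ 2 * Derive_n (e_b E) 2 t)).
  - apply (filter_imp (fun t => 0 < t)).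
    + intros t Ht; symmetry; apply is_derive_unique, is_derive_p_b; assumption.
    + apply (open_gt 0); exact Hr.
  - destruct (e_b_derivatives E r H Hr) as [_ [H2 H3]].
    apply ex_derive_continuous with (f := fun t => 2 * t * Derive (e_b E) t + t ^ 2 * Derive_n (e_b E) 2 t).
    apply @ex_derive_plus; apply ex_derive_mult; try (auto_derive; exact I).
    + eexists; exact H2.
    + exact H3.
Qed.

Lemma is_derive_inv (v : R) : 0 < v -> is_derive (fun t => / t) v (- / v ^ 2).
Proof. intros Hv; auto_derive; [lra | field; lra]. Qed.

Lemma is_derive_p_b_hat (E : eos) (v : R) :
  barotropic_regular E -> 0 < v -> is_derive (p_b_hat E) v (- (ab2_hat E v / v ^ 2)).
Proof.
  intros H Hv.
  assert (Hi : 0 < / v) by (apply Rinv_0_lt_compat; exact Hv).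
  pose proof (is_derive_comp (p_b E) (fun t => / t) v _ _
    (Derive_correct _ _ (ex_intro _ _ (is_derive_p_b E _ H Hi))) (is_derive_inv v Hv)) as Hc.
  replace (- (ab2_hat E v / v ^ 2)) with (scal (- / v ^ 2) (Derive (p_b E) (/ v))); [exact Hc |].
  unfold ab2_hat, ab2, scal; simpl; unfold mult; simpl; field; lra.
Qed.

Lemma is_derive_e_b_hat (E : eos) (v : R) :
  barotropic_regular E -> 0 < v -> is_derive (e_b_hat E) v (- p_b_hat E v).
Proof.
  intros H Hv.
  assert (Hi : 0 < / v) by (apply Rinv_0_lt_compat; exact Hv).
  destruct (e_b_derivatives E _ H Hi) as [He _].
  pose proof (is_derive_comp (e_b E) (fun t => / t) v _ _ He (is_derive_inv v Hv)) as Hc.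
  replace (- p_b_hat E v) with (scal (- / v ^ 2) (Derive (e_b E) (/ v))); [exact Hc |].
  unfold p_b_hat, p_b, scal; simpl; unfold mult; simpl; field; lra.
Qed.

Lemma ab2_hat_nonneg (E : eos) (v : R) :
  barotropic_regular E -> 0 < v -> 0 <= ab2_hat E v / v ^ 2.
Proof.
  intros H Hv. apply Rdiv_le_0_compat; [| nra].
  apply H, Rinv_0_lt_compat, Hv.
Qed.

Lemma p_b_hat_chord (E : eos) (v w M : R) :
  barotropic_regular E -> 0 < v <= w ->
  (forall t, v <= t <= w -> ab2_hat E t / t ^ 2 <= M) ->
  p_b_hat E v - p_b_hat E w <= M * (w - v).
Proof.
  intros H Hv HM.
  destruct (MVT_is_derive (p_b_hat E) (fun t => - (ab2_hat E t / t ^ 2)) v w)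
    as [c [Hc Hc']]; [lra | |].
  { intros t Ht; apply is_derive_p_b_hat; [exact H | lra]. }
  specialize (HM c Hc). nra.
Qed.

Lemma p_b_hat_decreasing (E : eos) (v w : R) :
  barotropic_regular E -> 0 < v <= w -> p_b_hat E w <= p_b_hat E v.
Proof.
  intros H Hv.
  destruct (MVT_is_derive (p_b_hat E) (fun t => - (ab2_hat E t / t ^ 2)) v w)
    as [c [Hc Hc']]; [lra | |].
  { intros t Ht; apply is_derive_p_b_hat; [exact H | lra]. }
  pose proof (ab2_hat_nonneg E c H ltac:(lra)). nra.
Qed.

(** [mu] is the barotropic pressure at an intermediate volume. Its bounds are all that the flux
    estimates use of the energy difference in [A_b_hat]. *)
Lemma e_b_hat_chord (E : eos) (v w : R) :
  barotropic_regular E -> 0 < v <= w ->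
  exists mu, p_b_hat E w <= mu <= p_b_hat E v /\
    e_b_hat E v - e_b_hat E w = mu * (w - v).
Proof.
  intros H Hv.
  destruct (MVT_is_derive (e_b_hat E) (fun t => - p_b_hat E t) v w)
    as [c [Hc Hc']]; [lra | |].
  { intros t Ht; apply is_derive_e_b_hat; [exact H | lra]. }
  exists (p_b_hat E c); split; [| lra].
  split; apply p_b_hat_decreasing; try assumption; lra.
Qed.

Lemma ab2_hat_max (E : eos) (a b : R) :
  barotropic_regular E -> 0 < a <= b ->
  exists M, is_max_on (fun t => ab2_hat E t / t ^ 2) a b M /\ 0 <= M.
Proof.
  intros H Hab.
  destruct (continuity_ab_maj (fun t => ab2_hat E t / t ^ 2) a b) as [t [Hmax Ht]];
    [lra | |].
  { intros c Hc. apply continuity_pt_filterlim.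
    change (continuous (fun t => mult (ab2_hat E t) (/ t ^ 2)) c).
    apply (continuous_mult (K := R_AbsRing)).
    - apply (continuous_comp (fun t => / t) (ab2 E)).
      + apply continuous_Rinv; lra.
      + apply continuous_ab2; [exact H | apply Rinv_0_lt_compat; lra].
    - apply (ex_derive_continuous (fun t => / t ^ 2)); auto_derive.
      assert (0 < c ^ 2) by (apply pow_lt; lra). simpl in *; lra. }
  exists (ab2_hat E t / t ^ 2); split; [| apply ab2_hat_nonneg; [exact H | lra]].
  split; [exists t; auto | exact Hmax].
Qed.

(** * Existence and position of the hydrodynamical shock volume *)

(** Compare with a volume [w] near 0, where the energy is at least [q_ref E], and let the error
    [p_inf E * w] drop below any [eps]. *)
Lemma e_hat_lower_bound (E : eos) (v p : R) :
  complete_eos E -> hydro_energy_bounds E -> 0 < v -> - p_inf E < p ->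
  q_ref E + p_inf E * v <= e_hat E v p.
Proof.
  intros Heos Hb Hv Hp.
  apply le_epsilon; intros eps He.
  set (w := Rmin v (eps / (Rabs (p_inf E) + 1))).
  pose proof (Rabs_pos (p_inf E)); pose proof (Rle_abs (p_inf E)).
  assert (Hw : 0 < w) by (apply Rmin_pos; [lra | apply Rdiv_lt_0_compat; lra]).
  assert (Hwv : w <= v) by apply Rmin_l.
  assert (Hwe : w * (Rabs (p_inf E) + 1) <= eps).
  { apply Rle_trans with (eps / (Rabs (p_inf E) + 1) * (Rabs (p_inf E) + 1)).
    - apply Rmult_le_compat_r; [lra | apply Rmin_r].
    - apply Req_le; field; lra. }
  pose proof (e_hat_increasing E w v p p Heos Hb ltac:(lra) ltac:(lra)) as Hi.
  destruct Hb as [Hb _]; destruct (Hb w p Hw Hp) as [_ [_ Hq]].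
  assert (p_inf E * w <= Rabs (p_inf E) * w) by (apply Rmult_le_compat_r; lra).
  lra.
Qed.

(** As [w] tends to 0, the Hugoniot function has a limit which is at most [- k] by
    [e_hat_lower_bound]. The chosen [w] keeps each of the two errors, in the energy and in the
    linear term, within [k / 3]. *)
Lemma hugoniot_negative_near_0 (E : eos) (P : R) (W : state) :
  complete_eos E -> hydro_energy_bounds E -> admissible E W -> - p_inf E < P ->
  exists w, 0 < w < vol W /\
    e_hat E w P - e_hat E (vol W) (ph E W) + / 2 * (P + ph E W) * (w - vol W) < 0.
Proof.
  intros Heos Hb [Hr Hp] HP.
  assert (Hv : 0 < vol W) by (apply Rinv_0_lt_compat; exact Hr).
  pose proof (e_hat_lower_bound E (vol W) (ph E W) Heos Hb Hv Hp) as Hl.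
  set (k := (/ 2 * (P + ph E W) + p_inf E) * vol W).
  assert (Hk : 0 < k) by (apply Rmult_lt_0_compat; lra).
  destruct Hb as [_ [_ Hlim]].
  assert (Hk3 : 0 < k / 3) by lra.
  destruct (Hlim P HP (ball (q_ref E) (mkposreal _ Hk3)) (locally_ball _ _)) as [d Hd].
  set (c := Rabs (/ 2 * (P + ph E W))).
  assert (Hc : 0 <= c) by apply Rabs_pos.
  assert (Hcl : / 2 * (P + ph E W) <= c) by apply Rle_abs.
  set (w := Rmin (Rmin d (vol W) / 2) (k / 3 / (c + 1))).
  assert (Hd0 : 0 < Rmin d (vol W)) by (apply Rmin_pos; [apply cond_pos | exact Hv]).
  assert (Hw : 0 < w) by (apply Rmin_pos; [lra | apply Rdiv_lt_0_compat; lra]).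
  assert (Hw1 : w <= Rmin d (vol W) / 2) by apply Rmin_l.
  pose proof (Rmin_l d (vol W)); pose proof (Rmin_r d (vol W)).
  assert (Hw2 : w * (c + 1) <= k / 3).
  { apply Rle_trans with (k / 3 / (c + 1) * (c + 1)).
    - apply Rmult_le_compat_r; [lra | apply Rmin_r].
    - apply Req_le; field; lra. }
  exists w; split; [lra |].
  assert (Hball : ball (q_ref E) (k / 3) (e_hat E w P)).
  { apply (Hd w); [| exact Hw].
    apply Rabs_def1; unfold minus, plus, opp; simpl; lra. }
  apply Rabs_def2 in Hball; unfold minus, plus, opp in Hball; simpl in Hball.
  assert (/ 2 * (P + ph E W) * w <= c * w) by (apply Rmult_le_compat_r; lra).
  unfold k in *; lra.
Qed.

(** [epsilon] satisfies its predicate once a solution exists, and the intermediate value theorem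
    provides one. *)
Lemma xi_h_spec (E : eos) (P : R) (W : state) :
  complete_eos E -> hydro_energy_bounds E -> admissible E W -> - p_inf E < P ->
  0 < xi_h E P W /\ hydro_hugoniot E P W (xi_h E P W).
Proof.
  intros Heos Hb HW HP.
  unfold xi_h; apply epsilon_spec.
  destruct (hugoniot_negative_near_0 E P W Heos Hb HW HP) as [a [Ha Hneg]].
  destruct HW as [Hr Hp].
  assert (Hv : 0 < vol W) by (apply Rinv_0_lt_compat; exact Hr).
  set (h := fun w => e_hat E w P - e_hat E (vol W) (ph E W) + / 2 * (P + ph E W) * (w - vol W)).
  set (k := / 2 * (P + ph E W) + p_inf E).
  assert (Hk : 0 < k) by (unfold k; lra).
  assert (Hinc : forall w, a <= w -> h a + k * (w - a) <= h w).
  { intros w Hw.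
    pose proof (e_hat_increasing E a w P P Heos Hb ltac:(lra) ltac:(lra)).
    unfold h, k; lra. }
  (* The linear growth [Hinc] gives [1 <= h b] at this point. *)
  set (b := a + (1 - h a) / k).
  assert (Hha : h a < 0) by exact Hneg.
  assert (Hab : a < b).
  { unfold b. assert (0 < (1 - h a) / k) by (apply Rdiv_lt_0_compat; lra). lra. }
  assert (Hhb : 0 < h b).
  { specialize (Hinc b ltac:(lra)).
    replace (k * (b - a)) with (1 - h a) in Hinc by (unfold b; field; lra). lra. }
  destruct (IVT_interv h a b) as [z [Hz Hz0]]; try assumption.
  { intros w Hw.
    destruct (e_hat_partials E w P Heos ltac:(lra) HP) as [H1 _].
    assert (H2 : is_derive (fun w => / 2 * (P + ph E W) * (w - vol W)
                   - e_hat E (vol W) (ph E W)) w (/ 2 * (P + ph E W)))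
      by (auto_derive; [exact I | ring]).
    apply derivable_continuous_pt.
    exists (Derive (fun w => e_hat E w P) w + / 2 * (P + ph E W)).
    apply is_derive_Reals.
    eapply is_derive_ext; [| exact (is_derive_plus _ _ _ _ _ H1 H2)].
    intros t; unfold h, plus; simpl; ring. }
  exists z; split; [lra | exact Hz0].
Qed.

(** To the right of [vol W] the Hugoniot function is at least [(/ 2 * (P + ph E W) + p_inf E) * (w -
    vol W)], hence positive. *)
Lemma xi_h_le (E : eos) (P : R) (W : state) :
  complete_eos E -> hydro_energy_bounds E -> admissible E W -> - p_inf E < P ->
  ph E W <= P -> xi_h E P W <= vol W.
Proof.
  intros Heos Hb HW HP Hle.
  destruct (xi_h_spec E P W Heos Hb HW HP) as [Hx H0].
  destruct HW as [Hr Hp].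
  assert (Hv : 0 < vol W) by (apply Rinv_0_lt_compat; exact Hr).
  apply Rnot_lt_le; intros Hlt.
  pose proof (e_hat_increasing E (vol W) (xi_h E P W) (ph E W) P Heos Hb
                ltac:(lra) ltac:(lra)).
  assert (0 < (/ 2 * (P + ph E W) + p_inf E) * (xi_h E P W - vol W))
    by (apply Rmult_lt_0_compat; lra).
  unfold hydro_hugoniot in H0; lra.
Qed.

Lemma xi_h_ge (E : eos) (P : R) (W : state) :
  complete_eos E -> hydro_energy_bounds E -> admissible E W -> - p_inf E < P ->
  P <= ph E W -> vol W <= xi_h E P W.
Proof.
  intros Heos Hb HW HP Hle.
  destruct (xi_h_spec E P W Heos Hb HW HP) as [Hx H0].
  destruct HW as [Hr Hp].
  apply Rnot_lt_le; intros Hlt.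
  pose proof (e_hat_increasing E (xi_h E P W) (vol W) P (ph E W) Heos Hb
                ltac:(lra) ltac:(lra)).
  assert (0 < (/ 2 * (P + ph E W) + p_inf E) * (vol W - xi_h E P W))
    by (apply Rmult_lt_0_compat; lra).
  unfold hydro_hugoniot in H0; lra.
Qed.

(** * Sign of the velocity change across an elementary wave *)

Lemma ex_RInt_sound_speed (E : eos) (s r1 r2 : R) :
  complete_eos E -> barotropic_regular E -> 0 < r1 <= r2 ->
  (forall v, / r2 <= v <= / r1 -> vs_dom E v s) ->
  ex_RInt (fun t => / t * sqrt (ah2 E (/ t) s + ab2 E t)) r1 r2.
Proof.
  intros Heos H Hr Hdom.
  apply (ex_RInt_continuous (V := R_CompleteNormedModule)); intros t Ht.
  rewrite Rmin_left, Rmax_right in Ht by lra.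
  assert (Hti : 0 < / t) by (apply Rinv_0_lt_compat; lra).
  assert (Hinv : continuous (fun t => / t) t)
    by (apply continuous_Rinv; lra).
  apply (continuous_mult (K := R_AbsRing)); [exact Hinv |].
  apply continuous_sqrt_comp, (continuous_plus (V := R_NormedModule)).
  - apply (continuous_comp (fun t => / t) (fun v => ah2 E v s)); [exact Hinv |].
    apply (ex_derive_continuous (fun v => ah2 E v s)); unfold ah2.
    apply ex_derive_mult; [auto_derive; exact I |].
    eexists; apply p_hat_derive; [exact Heos |].
    apply Hdom; split; apply Rinv_le_contravar; lra.
  - apply continuous_ab2; [exact H | lra].
Qed.

Lemma sound_speed_RInt_nonneg (E : eos) (s r1 r2 : R) :
  complete_eos E -> barotropic_regular E -> 0 < r1 <= r2 ->
  (forall v, / r2 <= v <= / r1 -> vs_dom E v s) ->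
  0 <= RInt (fun t => / t * sqrt (ah2 E (/ t) s + ab2 E t)) r1 r2.
Proof.
  intros Heos H Hr Hdom.
  apply RInt_ge_0; [lra | apply ex_RInt_sound_speed; assumption |].
  intros t Ht; apply Rmult_le_pos; [apply Rlt_le, Rinv_0_lt_compat; lra | apply sqrt_pos].
Qed.

Lemma total_pressure (E : eos) (W : state) : p W = ph E W + p_b_hat E (vol W).
Proof. unfold ph; ring. Qed.

(** Across a shock the total pressure cannot fall, because [p_b_hat] decreases in volume; in a fan a
    nonnegative function is integrated towards larger density. The common sign lets the first wave
    be compared with the whole sum [fC]. *)
Lemma wave_f_compressive (E : eos) (k : wave_kind) (Wm Wp : state) :
  complete_eos E -> barotropic_regular E -> admissible E Wm -> admissible E Wp ->
  elementary_wave E k Wm Wp -> ph E Wm <= ph E Wp -> vol Wp <= vol Wm ->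
  0 <= wave_f E k Wm Wp.
Proof.
  intros Heos H [Hm _] [Hp _] Hw HP Hv.
  assert (Hvp : 0 < vol Wp) by (apply Rinv_0_lt_compat; exact Hp).
  destruct k; simpl in *.
  - unfold fS.
    pose proof (p_b_hat_decreasing E (vol Wp) (vol Wm) H ltac:(lra)).
    destruct (Rle_dec (p Wm) (p Wp)) as [_ | Hn].
    + rewrite Rmult_1_l; apply Rmult_le_pos; apply sqrt_pos.
    + exfalso; apply Hn; rewrite !(total_pressure E); lra.
  - destruct Hw as [_ [_ [Hdom _]]].
    apply sound_speed_RInt_nonneg; auto.
    + split; [exact Hm |].
      rewrite <- (Rinv_inv (rho Wm)), <- (Rinv_inv (rho Wp)).
      apply Rinv_le_contravar; assumption.
    + intros v Hvv; apply Hdom; unfold between.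
      rewrite Rmin_right, Rmax_left by exact Hv; exact Hvv.
Qed.

Lemma wave_f_expansive (E : eos) (k : wave_kind) (Wm Wp : state) :
  complete_eos E -> barotropic_regular E -> admissible E Wm -> admissible E Wp ->
  elementary_wave E k Wm Wp -> ph E Wp <= ph E Wm -> vol Wm <= vol Wp ->
  wave_f E k Wm Wp <= 0.
Proof.
  intros Heos H [Hm _] [Hp _] Hw HP Hv.
  assert (Hvm : 0 < vol Wm) by (apply Rinv_0_lt_compat; exact Hm).
  destruct k; simpl in *.
  - unfold fS.
    pose proof (p_b_hat_decreasing E (vol Wm) (vol Wp) H ltac:(lra)).
    destruct (Rle_dec (p Wm) (p Wp)) as [Hle | _].
    (* The hypotheses force [p Wp <= p Wm], so the positive branch of [fS] occurs only for equal
       pressures. *)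
    + replace (p Wp - p Wm) with 0
        by (rewrite !(total_pressure E) in *; lra).
      rewrite Rabs_R0, sqrt_0; lra.
    + pose proof (Rmult_le_pos _ _ (sqrt_pos (Rabs (p Wp - p Wm)))
                    (sqrt_pos (Rabs (vol Wm - vol Wp)))); lra.
  - destruct Hw as [_ [_ [Hdom _]]].
    assert (Hr : rho Wp <= rho Wm).
    { rewrite <- (Rinv_inv (rho Wm)), <- (Rinv_inv (rho Wp)).
      apply Rinv_le_contravar; assumption. }
    assert (Hdom' : forall v, / rho Wm <= v <= / rho Wp -> vs_dom E v (entropy_of E Wm)).
    { intros v Hvv; apply Hdom; unfold between.
      rewrite Rmin_left, Rmax_right by exact Hv; exact Hvv. }
    unfold fR; rewrite <- opp_RInt_swap by (apply ex_RInt_sound_speed; auto).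
    pose proof (sound_speed_RInt_nonneg E (entropy_of E Wm) (rho Wp) (rho Wm) Heos H
                  (conj Hp Hr) Hdom') as Hpos.
    unfold opp; simpl; lra.
Qed.

Lemma sum_f_R0_ge_first (f : nat -> R) (m : nat) :
  (forall k, (k <= m)%nat -> 0 <= f k) -> f 0%nat <= sum_f_R0 f m.
Proof.
  induction m as [| m IH]; intros Hf; simpl; [lra |].
  pose proof (Hf (S m) (le_n _)).
  specialize (IH (fun k Hk => Hf k (le_S _ _ Hk))); lra.
Qed.

Lemma sum_f_R0_le_first (f : nat -> R) (m : nat) :
  (forall k, (k <= m)%nat -> f k <= 0) -> sum_f_R0 f m <= f 0%nat.
Proof.
  induction m as [| m IH]; intros Hf; simpl; [lra |].
  pose proof (Hf (S m) (le_n _)).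
  specialize (IH (fun k Hk => Hf k (le_S _ _ Hk))); lra.
Qed.

(** * Jump relations across shocks *)

Lemma vol_pos (E : eos) (W : state) : admissible E W -> 0 < vol W.
Proof. intros [Hr _]; apply Rinv_0_lt_compat, Hr. Qed.

Lemma fS_sqr (Wm Wp : state) :
  fS Wm Wp ^ 2 = Rabs (p Wp - p Wm) * Rabs (vol Wm - vol Wp).
Proof.
  unfold fS.
  rewrite <- (sqrt_sqrt (Rabs (p Wp - p Wm))) at 2 by apply Rabs_pos.
  rewrite <- (sqrt_sqrt (Rabs (vol Wm - vol Wp))) at 2 by apply Rabs_pos.
  destruct (Rle_dec (p Wm) (p Wp)); ring.
Qed.

Lemma fS_h_sqr (E : eos) (P : R) (W : state) :
  fS_h E P W ^ 2 = Rabs (P - ph E W) * Rabs (vol W - xi_h E P W).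
Proof.
  unfold fS_h.
  rewrite <- (sqrt_sqrt (Rabs (P - ph E W))) at 2 by apply Rabs_pos.
  rewrite <- (sqrt_sqrt (Rabs (vol W - xi_h E P W))) at 2 by apply Rabs_pos.
  destruct (total_order_T 0 (P - ph E W)) as [[H | H] | H].
  - rewrite sign_eq_1 by exact H; ring.
  - rewrite <- H, sign_0, Rabs_R0, sqrt_0; ring.
  - rewrite sign_eq_m1 by exact H; ring.
Qed.

Lemma fS_h_pos_inv (E : eos) (P : R) (W : state) :
  0 < fS_h E P W -> ph E W < P /\ vol W <> xi_h E P W.
Proof.
  unfold fS_h; intros H.
  pose proof (sqrt_pos (Rabs (P - ph E W))).
  pose proof (sqrt_pos (Rabs (vol W - xi_h E P W))).
  split.
  - apply Rnot_le_lt; intros [Hlt | Heq].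
    + rewrite sign_eq_m1 in H by lra; nra.
    + rewrite Heq, Rminus_diag, sign_0 in H; lra.
  - intros Heq; rewrite Heq, Rminus_diag, Rabs_R0, sqrt_0 in H; lra.
Qed.

Lemma fS_h_neg_inv (E : eos) (P : R) (W : state) :
  fS_h E P W < 0 -> P < ph E W /\ vol W <> xi_h E P W.
Proof.
  unfold fS_h; intros H.
  pose proof (sqrt_pos (Rabs (P - ph E W))).
  pose proof (sqrt_pos (Rabs (vol W - xi_h E P W))).
  split.
  - apply Rnot_le_lt; intros [Hlt | Heq].
    + rewrite sign_eq_1 in H by lra; nra.
    + rewrite Heq, Rminus_diag, sign_0 in H; lra.
  - intros Heq; rewrite Heq, Rminus_diag, Rabs_R0, sqrt_0 in H; lra.
Qed.

(** Strict rise of the pressure: otherwise [ph] and [p_b_hat] would agree on both sides, and the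
    jump relation would give the energy a difference quotient [- ph E Wm < p_inf E] in volume,
    against [e_hat_increasing]. *)
Lemma compressive_shock_relation (E : eos) (Wm Wp : state) :
  complete_eos E -> hydro_energy_bounds E -> barotropic_regular E ->
  admissible E Wm -> admissible E Wp -> shock E Wm Wp ->
  ph E Wm <= ph E Wp -> vol Wp <= vol Wm ->
  vol Wp < vol Wm /\ p Wm < p Wp /\
  exists mu, p_b_hat E (vol Wm) <= mu <= p_b_hat E (vol Wp) /\
    e_hat E (vol Wp) (ph E Wp) - e_hat E (vol Wm) (ph E Wm)
    = (/ 2 * (ph E Wp + ph E Wm) + / 2 * (p_b_hat E (vol Wp) + p_b_hat E (vol Wm)) - mu)
      * (vol Wm - vol Wp).
Proof.
  intros Heos Hb H Hm Hp [Hne [Hs _]] HP Hv.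
  assert (Hlt : vol Wp < vol Wm) by (destruct Hv; [assumption | congruence]).
  pose proof (vol_pos E Wp Hp) as Hvp.
  destruct (e_b_hat_chord E (vol Wp) (vol Wm) H ltac:(lra)) as [mu [Hmu Hmu']].
  assert (Hrel : e_hat E (vol Wp) (ph E Wp) - e_hat E (vol Wm) (ph E Wm)
    = (/ 2 * (ph E Wp + ph E Wm) + / 2 * (p_b_hat E (vol Wp) + p_b_hat E (vol Wm)) - mu)
      * (vol Wm - vol Wp)) by (unfold A_b_hat in Hs; lra).
  split; [exact Hlt | split; [| exists mu; split; assumption]].
  rewrite !(total_pressure E).
  apply Rnot_le_lt; intros Hle.
  assert (HPe : ph E Wp = ph E Wm) by lra.
  assert (Hbe : p_b_hat E (vol Wp) = p_b_hat E (vol Wm)) by lra.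
  assert (Hme : mu = p_b_hat E (vol Wm)) by lra.
  rewrite HPe, Hbe, Hme in Hrel.
  destruct Hm as [_ Hm].
  pose proof (e_hat_increasing E (vol Wp) (vol Wm) (ph E Wm) (ph E Wm) Heos Hb
                ltac:(lra) ltac:(lra)).
  assert (0 < (ph E Wm + p_inf E) * (vol Wm - vol Wp)) by (apply Rmult_lt_0_compat; lra).
  lra.
Qed.

Lemma expansive_shock_relation (E : eos) (Wm Wp : state) :
  complete_eos E -> hydro_energy_bounds E -> barotropic_regular E ->
  admissible E Wm -> admissible E Wp -> shock E Wm Wp ->
  ph E Wp <= ph E Wm -> vol Wm <= vol Wp ->
  vol Wm < vol Wp /\ p Wp < p Wm /\
  exists mu, p_b_hat E (vol Wp) <= mu <= p_b_hat E (vol Wm) /\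
    e_hat E (vol Wp) (ph E Wp) - e_hat E (vol Wm) (ph E Wm)
    = (mu - / 2 * (ph E Wp + ph E Wm) - / 2 * (p_b_hat E (vol Wp) + p_b_hat E (vol Wm)))
      * (vol Wp - vol Wm).
Proof.
  intros Heos Hb H Hm Hp [Hne [Hs _]] HP Hv.
  assert (Hlt : vol Wm < vol Wp) by (destruct Hv; [assumption | congruence]).
  pose proof (vol_pos E Wm Hm) as Hvm.
  destruct (e_b_hat_chord E (vol Wm) (vol Wp) H ltac:(lra)) as [mu [Hmu Hmu']].
  assert (Hrel : e_hat E (vol Wp) (ph E Wp) - e_hat E (vol Wm) (ph E Wm)
    = (mu - / 2 * (ph E Wp + ph E Wm) - / 2 * (p_b_hat E (vol Wp) + p_b_hat E (vol Wm)))
      * (vol Wp - vol Wm)) by (unfold A_b_hat in Hs; lra).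
  split; [exact Hlt | split; [| exists mu; split; assumption]].
  rewrite !(total_pressure E).
  apply Rnot_le_lt; intros Hle.
  assert (HPe : ph E Wp = ph E Wm) by lra.
  assert (Hbe : p_b_hat E (vol Wp) = p_b_hat E (vol Wm)) by lra.
  assert (Hme : mu = p_b_hat E (vol Wm)) by lra.
  rewrite HPe, Hbe, Hme in Hrel.
  destruct Hm as [_ Hm].
  pose proof (e_hat_increasing E (vol Wm) (vol Wp) (ph E Wm) (ph E Wm) Heos Hb
                ltac:(lra) ltac:(lra)).
  assert (0 < (ph E Wm + p_inf E) * (vol Wp - vol Wm)) by (apply Rmult_lt_0_compat; lra).
  lra.
Qed.

(** * From mass flux to the speed of the outermost wave *)

Lemma sigma_ge (Wm Wp : state) (X : R) :
  0 <= vol Wm ->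
  vol Wm ^ 2 * (Rabs (p Wp - p Wm) / Rabs (vol Wm - vol Wp)) <= X ->
  Defs.sigma Wm Wp >= u Wm - sqrt X.
Proof.
  intros Hv HX; unfold Defs.sigma, Q.
  rewrite <- (sqrt_pow2 (vol Wm)) at 1 by exact Hv.
  rewrite <- sqrt_mult_alt by apply pow2_ge_0.
  apply sqrt_le_1_alt in HX; lra.
Qed.

Lemma fC_compressive (E : eos) (n : nat) (W : nat -> state) (K : nat -> wave_kind) :
  complete_eos E -> barotropic_regular E -> left_composite_wave E n W K ->
  compressive E n W -> wave_f E (K 0%nat) (W 0%nat) (W 1%nat) <= fC E n W K.
Proof.
  intros Heos H [Hn [Had [Hel _]]] Hc.
  apply (sum_f_R0_ge_first (fun k => wave_f E (K k) (W k) (W (S k)))).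
  intros k Hk; apply wave_f_compressive; auto;
    try (apply Had; lia); try (apply Hel; lia); apply Hc; lia.
Qed.

Lemma fC_expansive (E : eos) (n : nat) (W : nat -> state) (K : nat -> wave_kind) :
  complete_eos E -> barotropic_regular E -> left_composite_wave E n W K ->
  expansive E n W -> fC E n W K <= wave_f E (K 0%nat) (W 0%nat) (W 1%nat).
Proof.
  intros Heos H [Hn [Had [Hel _]]] Hc.
  apply (sum_f_R0_le_first (fun k => wave_f E (K k) (W k) (W (S k)))).
  intros k Hk; apply wave_f_expansive; auto;
    try (apply Had; lia); try (apply Hel; lia); apply Hc; lia.
Qed.

Theorem proposition3p30
  (E : eos)
  (Heos : complete_eos E)
  (HA0 : hydro_hyperbolic E)
  (HA1 : hydro_energy_bounds E)
  (HA2 : barotropic_regular E)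
  (n : nat) (W : nat -> state) (K : nat -> wave_kind)
  (Hwave : left_composite_wave E n W K)
  (HA3 : fans_genuinely_nonlinear E n W K)
  (HA4 : shocks_liu E n W K)
  (HA5 : sonic_attachment E n W K)
  (Delta : R)
  (Hdir : (0 <= Delta /\ compressive E n W) \/ (Delta <= 0 /\ expansive E n W))
  (HfC : fC E n W K = Delta)
  (p_t : R)
  (Hp_t : - p_inf E < p_t)
  (HfS : Delta = fS_h E p_t (W 0%nat)) :
  let WL := W 0%nat in
  let v_t := xi_h E p_t WL in
  let lambda_t := u WL - vol WL * Q_h E p_t WL in
  let lambda1 := left_speed E (K 0%nat) (W 0%nat) (W 1%nat) in
  (K 0%nat = Fan ->
     lambda1 >= u WL - sqrt (ah2_of E WL + ab2 E (rho WL))) /\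
  (K 0%nat = Shock -> 0 <= Delta ->
     exists M, is_max_on (fun t => ab2_hat E t / t ^ 2) v_t (vol WL) M /\
       lambda1 >= u WL - sqrt ((u WL - lambda_t) ^ 2 + 2 * vol WL ^ 2 * M)) /\
  (K 0%nat = Shock -> Delta <= 0 ->
     exists M, is_max_on (fun t => ab2_hat E t / t ^ 2) (vol WL) v_t M /\
       lambda1 >= u WL - sqrt (ah2_of E WL + 2 * vol WL ^ 2 * M)).
Proof.
  intros WL v_t lambda_t lambda1.
  destruct (Hwave) as [Hn [Had [Hel _]]].
  assert (H0 : admissible E WL) by (apply Had; lia).
  assert (H1 : admissible E (W 1%nat)) by (apply Had; lia).
  assert (Hw : elementary_wave E (K 0%nat) WL (W 1%nat)) by (apply Hel; lia).
  assert (Hv0 : 0 < vol WL) by exact (vol_pos E WL H0).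
  assert (Hv1 : 0 < vol (W 1%nat)) by exact (vol_pos E _ H1).
  destruct (xi_h_spec E p_t WL Heos HA1 H0 Hp_t) as [Hvt Hug].
  fold v_t in Hvt, Hug; unfold hydro_hugoniot in Hug.
  fold WL in HfS.
  pose proof (fS_h_sqr E p_t WL) as Hsqr_t; fold v_t in Hsqr_t; rewrite <- HfS in Hsqr_t.
  pose proof (fS_sqr WL (W 1%nat)) as Hsqr.
  pose proof (proj2 H0) as Hp0.
  pose proof (proj2 H1) as Hp1.
  unfold lambda1; fold WL.
  (* The strict sign makes [Delta] nonzero when the outermost wave is a shock. Then the sign of
     [Delta] determines the direction of the wave, and the degenerate case [p_t = ph E WL] is
     excluded. *)
  assert (Hcomp : K 0%nat = Shock -> compressive E n W -> 0 < fS WL (W 1%nat) <= Delta).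
  { intros HK Hc; rewrite HK in Hw.
    destruct (Hc 0%nat ltac:(lia)) as [HP Hv]; fold WL in HP, Hv.
    destruct (compressive_shock_relation E WL (W 1%nat)) as [Hv' [Hp' _]]; auto.
    pose proof (fC_compressive E n W K Heos HA2 Hwave Hc) as Hle.
    pose proof (wave_f_compressive E Shock WL (W 1%nat) Heos HA2 H0 H1 Hw HP Hv) as Hpos.
    rewrite HK, HfC in Hle; simpl in Hle, Hpos; fold WL in Hle.
    split; [| exact Hle].
    destruct Hpos as [Hpos | Heq]; [exact Hpos | exfalso].
    rewrite <- Heq, !Rabs_right in Hsqr by lra.
    assert (0 < (p (W 1%nat) - p WL) * (vol WL - vol (W 1%nat)))
      by (apply Rmult_lt_0_compat; lra). lra. }
  assert (Hexp : K 0%nat = Shock -> expansive E n W -> Delta <= fS WL (W 1%nat) < 0).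
  { intros HK Hc; rewrite HK in Hw.
    destruct (Hc 0%nat ltac:(lia)) as [HP Hv]; fold WL in HP, Hv.
    destruct (expansive_shock_relation E WL (W 1%nat)) as [Hv' [Hp' _]]; auto.
    pose proof (fC_expansive E n W K Heos HA2 Hwave Hc) as Hle.
    pose proof (wave_f_expansive E Shock WL (W 1%nat) Heos HA2 H0 H1 Hw HP Hv) as Hneg.
    rewrite HK, HfC in Hle; simpl in Hle, Hneg; fold WL in Hle.
    split; [exact Hle |].
    destruct Hneg as [Hneg | Heq]; [exact Hneg | exfalso].
    rewrite Heq, !Rabs_left in Hsqr by lra.
    assert (0 < (p WL - p (W 1%nat)) * (vol (W 1%nat) - vol WL))
      by (apply Rmult_lt_0_compat; lra). lra. }
  split; [| split].
  - intros HK; rewrite HK; simpl; unfold lambda; lra.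
  - intros HK HD; rewrite HK in *; cbn [left_speed elementary_wave] in *.
    assert (Hc : compressive E n W).
    { destruct Hdir as [[_ Hc] | [HD' He]]; [exact Hc |].
      specialize (Hexp eq_refl He); lra. }
    specialize (Hcomp eq_refl Hc).
    destruct (Hc 0%nat ltac:(lia)) as [HP Hv]; fold WL in HP, Hv.
    destruct (compressive_shock_relation E WL (W 1%nat)) as [Hv' [Hp' [mu [Hmu He]]]]; auto.
    destruct (fS_h_pos_inv E p_t WL) as [Hpt Hvne]; [lra |]; fold v_t in Hvne.
    pose proof (xi_h_le E p_t WL Heos HA1 H0 Hp_t ltac:(lra)) as Hvle; fold v_t in Hvle.
    destruct (ab2_hat_max E v_t (vol WL) HA2 ltac:(lra)) as [M [HM HM0]].
    exists M; split; [exact HM |].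
    destruct HM as [_ HM].
    apply sigma_ge; [lra |].
    (* Because [ph E WL < p_t], the limit branch of [Q_h] is not reached. *)
    assert (HQ : Q_h E p_t WL ^ 2 = (p_t - ph E WL) / (vol WL - v_t)).
    { unfold Q_h; destruct (Req_EM_T p_t (ph E WL)) as [Heq | _]; [lra |].
      unfold Q_h_quot; fold v_t.
      rewrite (Rabs_right (p_t - _)), (Rabs_right (vol WL - _)) by lra.
      apply pow2_sqrt, Rlt_le, Rdiv_lt_0_compat; lra. }
    replace ((u WL - lambda_t) ^ 2) with (vol WL ^ 2 * Q_h E p_t WL ^ 2)
      by (unfold lambda_t; ring).
    rewrite HQ.
    rewrite !Rabs_right in Hsqr, Hsqr_t |- * by lra.
    assert (HDD : fS WL (W 1%nat) ^ 2 <= Delta ^ 2) by (apply pow_incr; lra).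
    rewrite Hsqr, Hsqr_t in HDD.
    pose proof (total_pressure E WL) as Ht0.
    pose proof (total_pressure E (W 1%nat)) as Ht1.
    pose proof (compressive_shock_flux E (vol WL) (ph E WL) (vol (W 1%nat)) (ph E (W 1%nat))
      (p_b_hat E (vol WL)) (p_b_hat E (vol (W 1%nat))) mu M v_t p_t Heos HA0 HA1) as Hf.
    replace (ph E (W 1%nat) + p_b_hat E (vol (W 1%nat)) - ph E WL - p_b_hat E (vol WL))
      with (p (W 1%nat) - p WL) in Hf by lra.
    assert (Hflux : (p (W 1%nat) - p WL) / (vol WL - vol (W 1%nat))
                    <= (p_t - ph E WL) / (vol WL - v_t) + 2 * M).
    { apply Hf; try assumption; try lra.
      (* [Hvv] puts the volumes of the shock inside the interval over which [M] is the maximum. *)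
      intros Hvv; apply p_b_hat_chord; [exact HA2 | lra |].
      intros t Ht; apply HM; lra. }
    apply (Rmult_le_compat_l (vol WL ^ 2)) in Hflux; [| apply pow2_ge_0].
    lra.
  - intros HK HD; rewrite HK in *; cbn [left_speed elementary_wave] in *.
    assert (Hc : expansive E n W).
    { destruct Hdir as [[HD' He] | [_ Hc]]; [| exact Hc].
      specialize (Hcomp eq_refl He); lra. }
    specialize (Hexp eq_refl Hc).
    destruct (Hc 0%nat ltac:(lia)) as [HP Hv]; fold WL in HP, Hv.
    destruct (expansive_shock_relation E WL (W 1%nat)) as [Hv' [Hp' [mu [Hmu He]]]]; auto.
    destruct (fS_h_neg_inv E p_t WL) as [Hpt Hvne]; [lra |]; fold v_t in Hvne.
    pose proof (xi_h_ge E p_t WL Heos HA1 H0 Hp_t ltac:(lra)) as Hvle; fold v_t in Hvle.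
    destruct (ab2_hat_max E (vol WL) v_t HA2 ltac:(lra)) as [M [HM HM0]].
    exists M; split; [exact HM |].
    destruct HM as [_ HM].
    apply sigma_ge; [lra |].
    rewrite !Rabs_left in Hsqr, Hsqr_t |- * by lra.
    assert (HDD : fS WL (W 1%nat) ^ 2 <= Delta ^ 2).
    { rewrite <- (pow2_abs Delta), <- pow2_abs; apply pow_incr; split; [apply Rabs_pos |].
      rewrite !Rabs_left by lra; lra. }
    rewrite Hsqr, Hsqr_t in HDD.
    pose proof (total_pressure E WL) as Ht0.
    pose proof (total_pressure E (W 1%nat)) as Ht1.
    assert (Hvt1 : vol (W 1%nat) <= v_t).
    { apply (expansive_shock_volume E (vol WL) (ph E WL) (vol (W 1%nat)) (ph E (W 1%nat))
        (p_b_hat E (vol WL)) (p_b_hat E (vol (W 1%nat))) mu v_t p_t); try assumption; try lra.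
      replace (ph E WL + p_b_hat E (vol WL) - ph E (W 1%nat) - p_b_hat E (vol (W 1%nat)))
        with (p WL - p (W 1%nat)) by lra.
      lra. }
    pose proof (expansive_shock_flux E (vol WL) (ph E WL) (vol (W 1%nat)) (ph E (W 1%nat))
      (p_b_hat E (vol WL)) (p_b_hat E (vol (W 1%nat))) mu M Heos HA0 HA1) as Hf.
    replace (ph E WL + p_b_hat E (vol WL) - ph E (W 1%nat) - p_b_hat E (vol (W 1%nat)))
      with (p WL - p (W 1%nat)) in Hf by lra.
    assert (Hflux : (p WL - p (W 1%nat)) / (vol (W 1%nat) - vol WL)
       <= - Derive (fun w => p_hat E w (entropy E (vol WL) (ph E WL))) (vol WL) + 2 * M).
    { apply Hf; try assumption; try lra.
      apply p_b_hat_chord; [exact HA2 | lra |].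
      intros t Ht; apply HM; lra. }
    apply (Rmult_le_compat_l (vol WL ^ 2)) in Hflux; [| apply pow2_ge_0].
    replace (- (p (W 1%nat) - p WL) / - (vol WL - vol (W 1%nat)))
      with ((p WL - p (W 1%nat)) / (vol (W 1%nat) - vol WL)) by (field; lra).
    unfold ah2_of, ah2, entropy_of; lra.
Qed.
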